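(* Graphs of maximum degree $3$ have unbounded anagram-free chromatic number; that is, for every positive integer $c$ there exists a graph $G$ with maximum degree $\Delta(G)=3$ such that $\phi(G) > c$.
   Context: Graphs are finite, simple and undirected. An anagram is a word of the form $W_1W_2$ where $W_1$ is a non-empty word and $W_2$ is a permutation of $W_1$ (i.e. each symbol occurs equally often in $W_1$ and $W_2$). A vertex colouring of a graph $G$ is a function $f:V(G)\to C$ where $C$ is a set of colours (no properness is assumed). A vertex colouring of $G$ is anagram-free if for every path $v_1,\dots,v_n$ that is a subgraph of $G$ (not necessarily induced), the sequence of colours $f(v_1)\cdots f(v_n)$ is not an anagram. The anagram-free chromatic number $\phi(G)$ is the minimum number of colours in an anagram-free vertex colouring of $G$. *)

(* Defs.v *)
From mathcomp Require Import all_boot.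

Set Implicit Arguments.
Unset Strict Implicit.
Unset Printing Implicit Defensive.

Record sgraph : Type := SGraph {
  vertex :> finType;
  adj : rel vertex;
  adj_sym : symmetric adj;
  adj_irrefl : irreflexive adj }.

Definition degree (G : sgraph) (v : G) : nat := #|[set u : G | adj v u]|.

Definition max_degree (G : sgraph) : nat := \max_(v : G) degree v.

Definition is_path (G : sgraph) (p : seq G) : bool :=
  [&& p != [::], uniq p & sorted (@adj G) p].

Definition anagram (C : eqType) (w : seq C) : Prop :=
  exists W1 W2 : seq C, [/\ w = W1 ++ W2, W1 <> [::] & perm_eq W1 W2].

Definition anagram_free (G : sgraph) (C : eqType) (f : G -> C) : Prop :=
  forall p : seq G, is_path p -> ~ anagram (map f p).

(* Boolean versions of the two previous predicates: the two halves of an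
   anagram have the same length, and the paths of G have at most #|G|
   vertices. *)
Definition anagramb (C : eqType) (w : seq C) : bool :=
  (w != [::]) && perm_eq (take (size w)./2 w) (drop (size w)./2 w).

Lemma anagramP (C : eqType) (w : seq C) : reflect (anagram w) (anagramb w).
Proof.
apply: (iffP andP) => [[w0 eqw]|[W1 [W2 [-> W1n0 eqW]]]].
  exists (take (size w)./2 w), (drop (size w)./2 w).
  split=> //; first by rewrite cat_take_drop.
  move=> t0; move: eqw; rewrite t0 perm_sym => /perm_nilP d0.
  by move: w0; rewrite -(cat_take_drop (size w)./2 w) t0 d0.
have half : (size (W1 ++ W2))./2 = size W1.
  by rewrite size_cat -(perm_size eqW) addnn doubleK.
rewrite half take_size_cat // drop_size_cat //; split=> //.
by case: W1 W1n0 {eqW half}.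
Qed.

Definition anagram_freeb (G : sgraph) (C : eqType) (f : G -> C) : bool :=
  [forall n : 'I_#|G|.+1, forall p : n.-tuple G,
    is_path p ==> ~~ anagramb (map f p)].

Lemma anagram_freeP (G : sgraph) (C : eqType) (f : G -> C) :
  reflect (anagram_free f) (anagram_freeb f).
Proof.
apply: (iffP forallP) => [H p pathp /anagramP|H n].
  have sz : size p < #|G|.+1.
    by case/and3P: pathp => _ up _; rewrite ltnS -(card_uniqP up) max_card.
  have /forallP/(_ (in_tuple p)) := H (Ordinal sz).
  by rewrite pathp /= => /negP.
by apply/forallP => p; apply/implyP => /H ?; apply/anagramP.
Qed.

Definition anagram_free_colourable (G : sgraph) (k : nat) : bool :=
  [exists f : {ffun G -> 'I_k}, anagram_freeb f].

Lemma anagram_free_colourableP (G : sgraph) (k : nat) :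
  reflect (exists f : G -> 'I_k, anagram_free f) (anagram_free_colourable G k).
Proof.
apply: (iffP existsP) => [[f /anagram_freeP Hf]|[f Hf]]; first by exists f.
exists (finfun f); apply/anagram_freeP => p pathp.
by rewrite (eq_map (ffunE f)); apply: Hf.
Qed.

Lemma anagram_free_inj (G : sgraph) (C : eqType) (f : G -> C) :
  injective f -> anagram_free f.
Proof.
move=> injf p /and3P[_ up _] [W1 [W2 [eqp W1n0 eqW]]].
move: up; rewrite -(map_inj_uniq injf) eqp cat_uniq => /and3P[_ /hasPn H _].
case: W1 W1n0 eqW H {eqp} => // a W1 _ eqW H.
have aW2 : a \in W2 by rewrite -(perm_mem eqW) mem_head.
by have /negP[] := H a aW2; apply: mem_head.
Qed.

Lemma ex_anagram_free_colourable (G : sgraph) :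
  exists k, anagram_free_colourable G k.
Proof.
exists #|G|; apply/anagram_free_colourableP.
by exists enum_rank; apply/anagram_free_inj/enum_rank_inj.
Qed.

Definition anagram_free_chromatic_number (G : sgraph) : nat :=
  ex_minn (ex_anagram_free_colourable G).

Lemma leq_anagram_free_chromatic_number (G : sgraph) (C : finType) (f : G -> C) :
  anagram_free f -> anagram_free_chromatic_number G <= #|C|.
Proof.
rewrite /anagram_free_chromatic_number; case: ex_minnP => k _ mink Hf.
apply/mink/anagram_free_colourableP; exists (enum_rank \o f) => p pathp.
case=> W1 [W2 [eqW W1n0 permW]]; apply: (Hf p pathp).
have eqp : map f p = map enum_val W1 ++ map enum_val W2.
  rewrite -map_cat -eqW -map_comp; apply: eq_map => x /=.
  by rewrite enum_rankK.
exists (map enum_val W1), (map enum_val W2); split=> //; last exact: perm_map.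
by case: W1 W1n0 {eqW permW eqp}.
Qed.

(* Main.v *)
Require Import Defs.
From mathcomp Require Import all_boot zify.

(** Colour a binary tree of height h with c colours.  A path from the root to a
    leaf has O(h) vertices, so that its colour counts take a number of values
    polynomial in h (of degree c), whereas there are 2 ^ h leaves.  For large h
    two such paths therefore carry the same multiset of colours.  Deleting their
    common upper part leaves two disjoint paths, still with equal colour
    multisets, that start at the two children of the lowest common ancestor v.
    In the tree they can only be joined through v, which spoils the anagram.

    The remedy is to make the two children of each vertex adjacent, so that the
    two paths can be joined without v.  To keep the degree at most 3, each tree
    vertex is first split into an upper end (adjacent to the parent, to the
    sibling and to the lower end) and a lower end (adjacent to the upper end and
    to the upper ends of the two children).  In other words, each branching is
    replaced by a triangle.

    [bend_path] shows that the two truncated paths together form a path,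
    [anagram_of_perm_descent] that equal colour multisets make it an anagram, and
    [triangle_tree_not_colourable] does the counting. *)

Set Implicit Arguments.
Unset Strict Implicit.
Unset Printing Implicit Defensive.

Lemma sorted_rev_cat (T : Type) (e : rel T) a s b t :
  symmetric e ->
  sorted e (rev (a :: s) ++ b :: t) = [&& path e a s, e a b & path e b t].
Proof.
move=> e_sym; rewrite rev_cons cat_rcons sorted_cat_cons /= -rev_cons.
by rewrite rev_sorted /=; congr andb; apply: eq_path => u v; apply: e_sym.
Qed.

(** * Coordinates in a binary tree with triangles *)

(** A triple (l, n, b) is a vertex of a binary tree whose branchings are
    replaced by triangles.  The tree vertex number n on level l (level 0 is that
    of the leaves, and the parent of n is n./2 one level up) is split into a
    lower end b = false, from which its two children hang, and an upper end
    b = true, which leads to its parent.  [stem] collects the edges of this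
    subdivided tree and [sibling] closes each branching into a triangle. *)
Definition stem (k k' : nat * nat * bool) : bool :=
  [&& ~~ k.2, k'.2 &
      (k.1 == k'.1) || ((k.1.1 == k'.1.1.+1) && (k.1.2 == k'.1.2./2))].

Definition sibling (k k' : nat * nat * bool) : bool :=
  [&& k.2, k'.2, k.1.1 == k'.1.1, k.1.2 != k'.1.2 & k.1.2./2 == k'.1.2./2].

(** At l = 0 the entry l.-1 is spurious; the list only has to contain all
    neighbours, as it serves for an upper bound on the degree. *)
Definition neighbours (k : nat * nat * bool) : seq (nat * nat * bool) :=
  let: (l, n, b) := k in
  if b then [:: (l, n, false); (l.+1, n./2, false);
                (l, if odd n then n.-1 else n.+1, true)]
  else [:: (l, n, true); (l.-1, n.*2, true); (l.-1, n.*2.+1, true)].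

Lemma key_adj_neighbours k k' :
  [|| stem k k', stem k' k | sibling k k'] -> k' \in neighbours k.
Proof.
case: k k' => [[l n] b] [[l' n'] b']; rewrite /stem /sibling /neighbours /=.
case: b b' => [] []; rewrite !inE !xpair_eqE /= ?andbF ?andbT ?orbF //=.
- by case: ifP; lia.
- by lia.
Qed.

(** * The graph and its degrees *)

Section TriangleTree.
Variable h : nat.

(** On level l only the numbers below 2 ^ (h - l) belong to the tree with root
    (h, 0); the same range of numbers on all levels makes the vertex type a
    plain product, at the cost of surplus vertices. *)
Definition node : Type := 'I_h.+1 * 'I_(2 ^ h) * bool.

Definition mk_node (l : 'I_h.+1) (n : 'I_(2 ^ h)) (b : bool) : node := (l, n, b).

Definition key (u : node) : nat * nat * bool :=
  (nat_of_ord u.1.1, nat_of_ord u.1.2, u.2).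

Lemma key_inj : injective key.
Proof. by move=> [[l n] b] [[l' n'] b'] [/ord_inj-> /ord_inj-> ->]. Qed.

Definition tri_adj (u v : node) : bool :=
  [|| stem (key u) (key v), stem (key v) (key u) | sibling (key u) (key v)].

Lemma tri_adj_sym : symmetric tri_adj.
Proof.
move=> u v; rewrite /tri_adj orbCA; congr [|| _, _ | _].
rewrite /sibling andbCA (eq_sym (key u).1.1) (eq_sym (key u).1.2).
by rewrite (eq_sym (key u).1.2./2).
Qed.

Lemma tri_adj_irrefl : irreflexive tri_adj.
Proof. by move=> [[l n] []]; rewrite /tri_adj /stem /sibling /= ?eqxx ?andbF. Qed.

Definition triangle_tree : sgraph := SGraph tri_adj_sym tri_adj_irrefl.

Lemma card_key_le (A : {set node}) (s : seq (nat * nat * bool)) :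
  (forall u, u \in A -> key u \in s) -> #|A| <= size s.
Proof.
move=> As; rewrite cardE -(size_map key); apply: uniq_leq_size.
  by rewrite (map_inj_uniq key_inj) enum_uniq.
by move=> _ /mapP[u + ->]; rewrite mem_enum => /As.
Qed.

Lemma degree_triangle_tree (v : triangle_tree) : degree v <= 3.
Proof.
have sz : size (neighbours (key v)) = 3 by rewrite /neighbours; case: ifP.
rewrite -sz; apply: card_key_le => u; rewrite inE; exact: key_adj_neighbours.
Qed.

Lemma max_degree_triangle_tree : 0 < h -> max_degree triangle_tree = 3.
Proof.
move=> h_gt0; apply/eqP; rewrite eqn_leq; apply/andP; split.
  by apply/bigmax_leqP => v _; apply: degree_triangle_tree.
have N0 : 0 < 2 ^ h by rewrite expn_gt0.
have N1 : 1 < 2 ^ h by rewrite -{1}(expn0 2) ltn_exp2l.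
have L1 : 1 < h.+1 by [].
pose o0 := Ordinal N0; pose o1 := Ordinal N1.
pose v : triangle_tree := mk_node ord0 o0 true.
apply: leq_trans (leq_bigmax v).
pose s := [:: mk_node ord0 o0 false; mk_node (Ordinal L1) o0 false;
              mk_node ord0 o1 true].
have s_uniq : uniq s by [].
rewrite -[3](card_uniqP s_uniq); apply/subset_leq_card/subsetP => u.
by rewrite !inE => /or3P[] /eqP->.
Qed.

(** * Root-to-leaf paths and bends *)

Lemma ancestor_subproof (x : 'I_(2 ^ h)) (i : nat) : x %/ 2 ^ i < 2 ^ h.
Proof. exact: leq_ltn_trans (leq_div _ _) (ltn_ord x). Qed.

Definition ancestor (x : 'I_(2 ^ h)) (i : nat) : 'I_(2 ^ h) :=
  Ordinal (ancestor_subproof x i).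

Lemma ancestorS x i : val (ancestor x i.+1) = (ancestor x i)./2.
Proof. by rewrite /= expnSr divnMA divn2. Qed.

Lemma eq_ancestor_ge x y i j :
  i <= j -> ancestor x i = ancestor y i -> ancestor x j = ancestor y j.
Proof.
move=> /subnKC<- /(congr1 val) /= e; apply: val_inj.
by rewrite /= expnD !divnMA e.
Qed.

(** The list runs downwards, from level k - 1 to the leaf x, so that the
    highest vertex, where two descents get joined, is exposed by computation. *)
Fixpoint descent (x : 'I_(2 ^ h)) (k : nat) : seq triangle_tree :=
  if k is j.+1 then
    [:: mk_node (inord j) (ancestor x j) true,
        mk_node (inord j) (ancestor x j) false & descent x j]
  else [::].

Lemma size_descent x k : size (descent x k) = k.*2.
Proof. by elim: k => //= k ->. Qed.

(** A descent meets each level in a single ancestor of its leaf: this makes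
    descents repetition-free, and makes two of them disjoint as long as the
    ancestors differ on all their levels. *)
Lemma mem_descent x k u : k <= h.+1 -> u \in descent x k ->
  u.1.1 < k /\ u.1.2 = ancestor x u.1.1.
Proof.
elim: k => //= k IH lt_kh; rewrite !inE => /or3P[/eqP->|/eqP->|/IH] /=.
- by rewrite inordK.
- by rewrite inordK.
by case=> [|lt_uk ->]; [exact: ltnW | rewrite ltnS ltnW].
Qed.

Lemma descent_uniq x k : k <= h.+1 -> uniq (descent x k).
Proof.
elim: k => //= k IH lt_kh; have le_kh := ltnW lt_kh.
rewrite inE negb_or IH // andbT -andbA; apply/and3P; split.
- by rewrite !xpair_eqE andbF.
- by apply/negP => /(mem_descent le_kh)[]; rewrite /= inordK // ltnn.
- by apply/negP => /(mem_descent le_kh)[]; rewrite /= inordK // ltnn.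
Qed.

Lemma descent_sorted x k : k <= h.+1 -> sorted (@adj triangle_tree) (descent x k).
Proof.
elim: k => //= k IH lt_kh.
rewrite {1}/tri_adj /stem /= eqxx /=.
case: k IH lt_kh => //= k IH lt_kh; rewrite IH ?andbT 1?ltnW //.
rewrite /tri_adj /stem /= !inordK ?[k < _]ltnW // eqxx.
by rewrite expnSr divnMA divn2 eqxx orbT.
Qed.

(** Up from the leaf x and down to the leaf y.  The joint is the edge between
    the two heads, which exists when k is the first level where the ancestors
    of x and y agree: the heads are then siblings. *)
Definition bend x y k : seq triangle_tree := rev (descent x k) ++ descent y k.

Lemma bend_path x y k : k < h.+1 ->
  (forall i, i <= k -> ancestor x i != ancestor y i) ->
  ancestor x k.+1 = ancestor y k.+1 ->
  is_path (bend x y k.+1).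
Proof.
move=> lt_kh neq_xy eq_xy; apply/and3P; split.
- by rewrite /bend -size_eq0 size_cat size_descent /= addnS.
- rewrite /bend cat_uniq rev_uniq !descent_uniq // andbT andTb.
  apply/hasPn => u /(mem_descent lt_kh)[lt_uk uy]; rewrite mem_rev.
  apply/negP => /(mem_descent lt_kh)[_ ux].
  by have := neq_xy u.1.1 lt_uk; rewrite -ux -uy eqxx.
have sx := descent_sorted x lt_kh; have sy := descent_sorted y lt_kh.
rewrite /bend [descent x _]/= [descent y _]/= sorted_rev_cat; last exact: adj_sym.
apply/and3P; split=> //.
rewrite /adj /= /tri_adj /stem /sibling /= !eqxx /=.
have := neq_xy k (leqnn k); rewrite -val_eqE /= => ->.
by have := congr1 val eq_xy; rewrite !ancestorS /= => ->.
Qed.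

(** From the meeting level on, the two paths to the root coincide, so that
    cutting off their common part removes the same colours from both words. *)
Lemma perm_descent_trunc (C : eqType) (f : triangle_tree -> C) x y k m :
  k <= m -> ancestor x k = ancestor y k ->
  perm_eq (map f (descent x m)) (map f (descent y m)) ->
  perm_eq (map f (descent x k)) (map f (descent y k)).
Proof.
move=> /subnKC<- eq_k; elim: (m - k) => [|d IH]; first by rewrite addn0.
rewrite addnS /= (eq_ancestor_ge (leq_addr d k) eq_k).
by rewrite !perm_cons.
Qed.

(** The bend at the lowest common ancestor has the two truncated descents as
    halves; the common ancestor itself is bypassed by the triangle edge, so
    that nothing is left over in the middle. *)
Lemma anagram_of_perm_descent (C : eqType) (f : triangle_tree -> C) x y :
  x != y -> perm_eq (map f (descent x h)) (map f (descent y h)) ->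
  ~ anagram_free f.
Proof.
move=> neq_xy perm_xy af.
have anc_h : ancestor x h == ancestor y h.
  by rewrite -val_eqE /= !divn_small.
have ex_meet : exists k, ancestor x k == ancestor y k by exists h.
case: (ex_minnP ex_meet) => -[|k] /eqP eq_k min_k.
  case/negP: neq_xy; have /(congr1 val) /= := eq_k.
  by rewrite !divn1 => /val_inj->.
have lt_kh : k < h := min_k _ anc_h.
have neq_le i : i <= k -> ancestor x i != ancestor y i.
  by move=> le_ik; apply/negP => /min_k; rewrite ltnNge le_ik.
apply: (af _ (bend_path (ltnW lt_kh) neq_le eq_k)).
exists (rev (map f (descent x k.+1))), (map f (descent y k.+1)); split.
- by rewrite /bend map_cat map_rev.
- by move/(congr1 size); rewrite size_rev.
by rewrite perm_rev; apply: perm_descent_trunc eq_k perm_xy.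
Qed.

(** Pigeonhole: there are 2 ^ h leaves, while the colour counts of a word of
    length 2h form a function from n colours to 2h + 1 values. *)
Lemma triangle_tree_not_colourable n :
  h.*2.+1 ^ n < 2 ^ h -> ~~ anagram_free_colourable triangle_tree n.
Proof.
move=> lt_n; apply/negP => /anagram_free_colourableP[f].
pose word x := map f (descent x h).
have lt_count x a : count_mem a (word x) < h.*2.+1.
  by rewrite ltnS -(size_descent x h) -(size_map f) count_size.
pose count_of x := [ffun a => Ordinal (lt_count x a)].
have /injectivePn[x [y neq_xy eq_count]] : ~~ injectiveb count_of.
  apply/injectiveP => /leq_card.
  by rewrite card_ffun !card_ord leqNgt lt_n.
apply: (anagram_of_perm_descent neq_xy); apply/allP => a _ /=.
by have /ffunP/(_ a) := eq_count; rewrite !ffunE => /(congr1 val) /= ->.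
Qed.

End TriangleTree.

(** * Choice of the height *)

(** The height h is 2 ^ m with m = 2c + 3.  Then 2h + 1 <= 2 ^ (m + 2), and it
    remains to see that (m + 2) c < 2 ^ m = (8 * 2 ^ c) * 2 ^ c, which holds
    factor by factor. *)
Lemma ex_poly_lt_exp2 c : exists2 h, 0 < h & h.*2.+1 ^ c < 2 ^ h.
Proof.
have c_lt : c < 2 ^ c by rewrite ltn_expl.
have m_gt : c.*2 + 5 <= 2 ^ (c + 3) by rewrite expnD; lia.
exists (2 ^ (c.*2 + 3)); first by rewrite expn_gt0.
apply: leq_ltn_trans (_ : (2 ^ (c.*2 + 5)) ^ c < _).
  by case: c {c_lt m_gt} => [|c] //; rewrite leq_exp2r // -addnn !expnD; lia.
rewrite -expnM ltn_exp2l //.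
have -> : 2 ^ (c.*2 + 3) = 2 ^ (c + 3) * 2 ^ c by rewrite -expnD; congr (2 ^ _); lia.
nia.
Qed.

Theorem theorem1 (c : nat) (hc : 0 < c) :
  exists G : sgraph, max_degree G = 3 /\ c < anagram_free_chromatic_number G.
Proof.
have [h h_gt0 lt_h] := ex_poly_lt_exp2 c.
exists (triangle_tree h); split; first exact: max_degree_triangle_tree.
rewrite /anagram_free_chromatic_number; case: ex_minnP => n col_n _.
rewrite ltnNge; apply/negP => le_nc.
have lt_n : h.*2.+1 ^ n < 2 ^ h by apply: leq_ltn_trans lt_h; rewrite leq_pexp2l.
by have := triangle_tree_not_colourable lt_n; rewrite col_n.
Qed.
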